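(* Let $O\subset\mathbb{R}^d$ be an open set, let $H$ be a class of Borel-measurable functions $O\to[-\infty,+\infty]$, and let $\mu$ be a charge on $O$ that is an $H$-balayage of a charge $\vartheta$ on $O$. Then the following hold. 1. If the constant function $1$ belongs to $H$, then $\vartheta(O)\le\mu(O)$. 2. If both constant functions $1$ and $-1$ belong to $H$, then $\vartheta(O)=\mu(O)$. 3. If $H'\subset H$, then $\mu$ is an $H'$-balayage of $\vartheta$. 4. If $O'\subset O$ is an open set with $\operatorname{supp}\vartheta\cup\operatorname{supp}\mu\subset O'$, then the restriction $\mu|_{O'}$ is a balayage of the restriction $\vartheta|_{O'}$ for the class $H|_{O'}:=\{h|_{O'}: h\in H\}$.
   Context: A charge on a Borel set $S$ is a Borel (Radon) signed measure on $S$. Balayage: let $\vartheta,\mu$ be charges on $S$ and let $H$ be a class of Borel-measurable functions $S\to[-\infty,+\infty]$ such that for every $h\in H$ the integrals $\int h\,d\vartheta$ and $\int h\,d\mu$ are well defined with values in $[-\infty,+\infty]$. The charge $\mu$ is called a balayage of $\vartheta$ for $H$ (an $H$-balayage of $\vartheta$) if $\int h\,d\vartheta\le\int h\,d\mu$ for all $h\in H$. *)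

(* Defs.v *)
From HB Require Import structures.
From mathcomp Require Import all_boot all_order all_algebra.
From mathcomp Require Import all_classical all_reals all_analysis.
From mathcomp Require Import measurable_realfun.
Set Implicit Arguments.
Unset Strict Implicit.
Unset Printing Implicit Defensive.
Import Order.TTheory GRing.Theory Num.Theory.
Import numFieldNormedType.Exports.

Local Open Scope classical_set_scope.
Local Open Scope ring_scope.
Local Open Scope ereal_scope.

(* $R^d$ with its Borel sigma-algebra, the topology of row vectors being the
   product topology. *)
Notation euclid R d := (g_sigma_algebraType (@open 'rV[R]_d)).

Lemma open_borel (R : realType) (d : nat) (U : set 'rV[R]_d) :
  open U -> measurable (U : set (euclid R d)).
Proof. by move=> oU; exact: sub_gen_smallest. Qed.

(* A charge on a Borel set [S], given by its Jordan decomposition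
   [cpos - cneg].  A Borel measure on [S] is represented by its unique extension
   to a Borel measure on $R^d$ that vanishes off [S].  In a Borel subset
   of $R^d$ the Radon measures are exactly the locally finite Borel measures;
   local finiteness is only required at the points of [S], and both parts of a
   charge may have infinite total mass. *)
Record charge_on (R : realType) (d : nat) (S : set (euclid R d)) := ChargeOn {
  cpos : {measure set (euclid R d) -> \bar R} ;
  cneg : {measure set (euclid R d) -> \bar R} ;
  cpos_off : cpos (~` S) = 0 ;
  cneg_off : cneg (~` S) = 0 ;
  cpos_locally_finite : forall x, S x ->
    exists U, [/\ @open 'rV[R]_d U, U x & cpos U < +oo] ;
  cneg_locally_finite : forall x, S x ->
    exists U, [/\ @open 'rV[R]_d U, U x & cneg U < +oo] ;
  cpos_cneg_singular : exists P,
    [/\ measurable P, cpos (~` P) = 0 & cneg P = 0] }.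

(* Meaningful only where it is not $oo - oo$. *)
Definition charge_val (R : realType) (d : nat) (S : set (euclid R d))
    (nu : charge_on S) (A : set (euclid R d)) : \bar R :=
  cpos nu A - cneg nu A.

Definition csupp (R : realType) (d : nat) (S : set (euclid R d))
    (nu : charge_on S) : set (euclid R d) :=
  [set x | S x /\ forall U, @open 'rV[R]_d U -> U x -> 0 < cpos nu U + cneg nu U].

Section restriction.
Context (R : realType) (d : nat) (S S' : set (euclid R d)).
Hypotheses (mS' : measurable S') (S'S : S' `<=` S).
Variable nu : charge_on S.

Let rpos : {measure set (euclid R d) -> \bar R} := mrestr (cpos nu) mS'.
Let rneg : {measure set (euclid R d) -> \bar R} := mrestr (cneg nu) mS'.

Let rpos_off : rpos (~` S') = 0.
Proof. by rewrite /= /mrestr setICl measure0. Qed.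

Let rneg_off : rneg (~` S') = 0.
Proof. by rewrite /= /mrestr setICl measure0. Qed.

Let rpos_locally_finite x : S' x ->
  exists U, [/\ @open 'rV[R]_d U, U x & rpos U < +oo].
Proof.
move=> /S'S/(cpos_locally_finite nu)[U [oU Ux Ufin]]; exists U; split=> //.
have mU := open_borel oU.
apply: le_lt_trans Ufin; rewrite /= /mrestr le_measure ?inE//.
exact: measurableI.
Qed.

Let rneg_locally_finite x : S' x ->
  exists U, [/\ @open 'rV[R]_d U, U x & rneg U < +oo].
Proof.
move=> /S'S/(cneg_locally_finite nu)[U [oU Ux Ufin]]; exists U; split=> //.
have mU := open_borel oU.
apply: le_lt_trans Ufin; rewrite /= /mrestr le_measure ?inE//.
exact: measurableI.
Qed.

Let rpos_rneg_singular : exists P,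
  [/\ measurable P, rpos (~` P) = 0 & rneg P = 0].
Proof.
have [P [mP pP nP]] := cpos_cneg_singular nu; exists P; split=> //.
- apply: (@subset_measure0 _ _ _ (cpos nu) _ (~` P)) => //.
  + by apply: measurableI => //; exact: measurableC.
  + exact: measurableC.
- apply: (@subset_measure0 _ _ _ (cneg nu) _ P) => //.
  exact: measurableI.
Qed.

Definition charge_restr : charge_on S' :=
  @ChargeOn R d S' rpos rneg rpos_off rneg_off
    rpos_locally_finite rneg_locally_finite rpos_rneg_singular.

End restriction.

(* The extension by 0 of a function on [S]; integrals are over [S],
   so the values off [S] are irrelevant. *)
Definition ext0 (R : realType) (d : nat) (S : set (euclid R d))
    (h : S -> \bar R) : euclid R d -> \bar R := valL_ 0 h.

Definition borel_fun (R : realType) (d : nat) (S : set (euclid R d))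
    (h : S -> \bar R) : Prop := measurable_fun S (ext0 h).

Definition mint (R : realType) (d : nat) (S : set (euclid R d))
    (m : {measure set (euclid R d) -> \bar R}) (h : S -> \bar R) : \bar R :=
  \int[m]_(x in S) ext0 h x.

Definition mint_defined (R : realType) (d : nat) (S : set (euclid R d))
    (m : {measure set (euclid R d) -> \bar R}) (h : S -> \bar R) : Prop :=
  \int[m]_(x in S) (ext0 h)^\+ x +? - \int[m]_(x in S) (ext0 h)^\- x.

Definition cint (R : realType) (d : nat) (S : set (euclid R d))
    (nu : charge_on S) (h : S -> \bar R) : \bar R :=
  mint (cpos nu) h - mint (cneg nu) h.

Definition cint_defined (R : realType) (d : nat) (S : set (euclid R d))
    (nu : charge_on S) (h : S -> \bar R) : Prop :=
  [/\ mint_defined (cpos nu) h, mint_defined (cneg nu) h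
    & mint (cpos nu) h +? - mint (cneg nu) h].

(* The first conjunct is the standing requirement on [H], relative to the two
   charges. *)
Definition balayage (R : realType) (d : nat) (S : set (euclid R d))
    (H : set (S -> \bar R)) (theta mu : charge_on S) : Prop :=
  (forall h, H h ->
     [/\ borel_fun h, cint_defined theta h & cint_defined mu h]) /\
  (forall h, H h -> cint theta h <= cint mu h).

(* Main.v *)
(* Items 1-3 are immediate.  For item 4, every point of [O] outside the support
   has a null neighborhood, and countably many rational balls cover the
   complement of the support, so it is null (Lindelof); removing it from the
   domain of integration changes neither the integrals nor their
   definedness. *)
Require Import Defs.
From HB Require Import structures.
From mathcomp Require Import all_boot all_order all_algebra.
From mathcomp Require Import all_classical all_reals all_analysis.
From mathcomp Require Import measurable_realfun.
Set Implicit Arguments.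
Unset Strict Implicit.
Unset Printing Implicit Defensive.
Import Order.TTheory GRing.Theory Num.Theory.
Import numFieldNormedType.Exports.

Local Open Scope classical_set_scope.
Local Open Scope ring_scope.
Local Open Scope ereal_scope.

(** A countable base of the topology, obtained by density of the rationals in each coordinate.
    Interiors are taken so that the members of the base are open. *)
Lemma rational_ball_sub (R : realType) (d : nat) (U : set 'rV[R]_d) x :
  open U -> U x -> exists (q : 'rV[rat]_d) (n : nat),
    (ball (map_mx ratr q : 'rV[R]_d) n.+1%:R^-1)° x /\
    (ball (map_mx ratr q : 'rV[R]_d) n.+1%:R^-1)° `<=` U.
Proof.
move=> oU Ux.
have /nbhs_ballP[e /= e0 xeU] : nbhs x U by exact: open_nbhs_nbhs.
(* The radius [r] is below [e / 2] and the center will lie within [r / 2] of [x], so the ball stays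
   within [r / 2 + r <= e] of [x]. *)
have [n] := ltr_add_invr (divr_gt0 e0 (@ltr0Sn R 1)).
rewrite add0r => ne; set r : R := n.+1%:R^-1%R.
have r0 : (0 < r)%R by rewrite invr_gt0.
have r20 : (0 < r / 2)%R by rewrite divr_gt0.
have qP i : exists q : rat, ball (x ord0 i) (r / 2)%R (ratr q).
  have [|q] := @rat_in_itvoo R (x ord0 i - r / 2)%R (x ord0 i + r / 2)%R.
    by rewrite ltrD2l gtrN.
  by rewrite in_itv /= -ltr_distlC distrC; exists q; rewrite /ball /= distrC.
(* The default [0] of [xget] is never reached, by [qP]. *)
pose q := (\row_i xget 0%R [set q | ball (x ord0 i) (r / 2)%R (ratr q)])%R.
have xq : ball x (r / 2)%R (map_mx ratr q : 'rV[R]_d).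
  split=> // i j; rewrite !mxE (ord1 i).
  by case: xgetP => [y _ //|/(_ _)]; have [y yP] := qP j => /(_ y)/(_ yP).
exists q, n; rewrite -/r; split.
  apply/nbhs_ballP; exists (r / 2)%R => //= y xy.
  by rewrite (splitr r); apply: ball_triangle xy; exact: ball_sym.
move=> y /interior_subset qy; apply: xeU.
apply: (@le_ball _ _ _ (r / 2 + r)%R); last exact: ball_triangle xq qy.
rewrite (splitr e) lerD// ltW// (le_lt_trans _ ne)// ler_pdivrMr//.
by rewrite ler_peMr ?ltW// ltr1n.
Qed.

(** The null members of the countable base cover [A]: the null neighborhood of a point contains a
    member around that point, which is then null too. *)
Lemma locally_null (R : realType) (d : nat)
    (m : {measure set (euclid R d) -> \bar R}) (A : set (euclid R d)) :
  measurable A ->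
  (forall x, A x -> exists U, [/\ @open 'rV[R]_d U, U x & m U = 0]) ->
  m A = 0.
Proof.
move=> mA A0.
pose B (qn : 'rV[rat]_d * nat) : set (euclid R d) :=
  (ball (map_mx ratr qn.1 : 'rV[R]_d) qn.2.+1%:R^-1%R)°.
have oB qn : @open 'rV[R]_d (B qn) by exact: open_interior.
(* Enumeration of the null balls; codes of other balls and invalid codes give the empty set. *)
pose F k := if unpickle k is Some qn then
  (if `[< m (B qn) = 0 >] then B qn else set0) else set0.
have F0 k : m.-negligible (F k).
  rewrite /F; case: unpickle => [qn|]; last exact: negligible_set0.
  case: asboolP => [mB|_]; last exact: negligible_set0.
  by exists (B qn); split => //; exact: open_borel.
apply: measure_negligible => //.
apply: (negligibleS _ (negligible_bigcup F0)) => x /A0[U [oU Ux mU]].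
have [q [n [Bx BU]]] := rational_ball_sub oU Ux.
exists (pickle (q, n)) => //; rewrite /F pickleK.
case: asboolP => // -[]; apply: (@subset_measure0 _ _ _ m _ U) => //.
- exact: open_borel (oB (q, n)).
- exact: open_borel.
Qed.

Lemma csupp_null (R : realType) (d : nat) (S S' : set (euclid R d))
    (nu : charge_on S) : measurable S -> measurable S' ->
  csupp nu `<=` S' -> cpos nu (S `\` S') = 0 /\ cneg nu (S `\` S') = 0.
Proof.
move=> mS mS' suppS'.
have nuU x : (S `\` S') x ->
    exists U, [/\ @open 'rV[R]_d U, U x, cpos nu U = 0 & cneg nu U = 0].
  (* Without such a neighborhood, [x] would be in the support, hence in [S']. A vanishing total mass
     forces both nonnegative parts to vanish. *)
  move=> [Sx S'x]; apply: contrapT => noU; apply/S'x/suppS'; split=> // U oU Ux.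
  rewrite lt0e adde_ge0// andbT; apply/negP => /eqP nuU0; apply: noU.
  by exists U; move/eqP: nuU0; rewrite padde_eq0// => /andP[/eqP ? /eqP ?].
by split; apply: locally_null => [|x /nuU[U [? ? ? ?]]];
  try (by exists U); exact: measurableD.
Qed.

Lemma ext0E (R : realType) (d : nat) (S : set (euclid R d)) (h : S -> \bar R)
    (a : S) : ext0 h (set_val a) = h a.
Proof. by rewrite -[RHS](congr1 (@^~ a) (valLK 0 h)). Qed.

Lemma ext0_subfun (R : realType) (d : nat) (S S' : set (euclid R d))
    (S'S : S' `<=` S) (h : S -> \bar R) :
  {in S', ext0 (h \o subfun S'S) =1 ext0 h}.
Proof.
move=> x xS'; have S'x := set_mem xS'.
(* Both sides evaluate [h] at the same point once [x] is seen as an element of the subtype. *)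
rewrite -[x]/(set_val (SigSub xS')) ext0E /=.
by rewrite -[RHS]/(ext0 h (set_val (subfun S'S (SigSub xS')))) ext0E.
Qed.

Section restriction_integral.
Context (R : realType) (d : nat) (S S' : set (euclid R d)).
Hypotheses (mS : measurable S) (mS' : measurable S') (S'S : S' `<=` S).
Variables (m : {measure set (euclid R d) -> \bar R}) (h : S -> \bar R).
Hypotheses (mh : borel_fun h) (m0 : m (S `\` S') = 0).

Let ge0_integral_mrestr (f : euclid R d -> \bar R) :
  measurable_fun S f -> (forall x, S x -> 0 <= f x) ->
  \int[mrestr m mS']_(x in S') f x = \int[m]_(x in S) f x.
Proof.
(* The restricted measure agrees with [m] on subsets of [S'], and for nonnegative functions a null
   set can be discarded without integrability. *)
move=> mf f0; rewrite (eq_measure_integral m) => [|A mA AS']; last first.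
  by rewrite /= /mrestr setIidl.
rewrite [RHS](@ge0_negligible_integral _ _ _ m S (S `\` S') f)//.
  by rewrite setDD setIidr.
exact: measurableD.
Qed.

(** Positive and negative parts are compared separately because together they determine both the
    value of the integral and its definedness, infinite values included. *)
Let parts :
  \int[mrestr m mS']_(x in S') (ext0 (h \o subfun S'S))^\+ x =
    \int[m]_(x in S) (ext0 h)^\+ x /\
  \int[mrestr m mS']_(x in S') (ext0 (h \o subfun S'S))^\- x =
    \int[m]_(x in S) (ext0 h)^\- x.
Proof.
split; rewrite -ge0_integral_mrestr.
- by apply: eq_integral => x xS'; rewrite !funeposE ext0_subfun.
- exact: measurable_funepos.
- by [].
- by apply: eq_integral => x xS'; rewrite !funenegE ext0_subfun.
- exact: measurable_funeneg.
- by [].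
Qed.

Lemma mint_mrestr : mint (mrestr m mS') (h \o subfun S'S) = mint m h.
Proof. by have [p n] := parts; rewrite /mint integralE p n -integralE. Qed.

Lemma mint_defined_mrestr :
  mint_defined (mrestr m mS') (h \o subfun S'S) = mint_defined m h.
Proof. by have [p n] := parts; rewrite /mint_defined p n. Qed.

End restriction_integral.

Lemma borel_fun_subfun (R : realType) (d : nat) (S S' : set (euclid R d))
    (S'S : S' `<=` S) (h : S -> \bar R) :
  measurable S -> borel_fun h -> borel_fun (h \o subfun S'S).
Proof.
move=> mS mh; apply: (eq_measurable_fun (ext0 h)).
  by move=> x xS'; rewrite ext0_subfun.
exact: measurable_funS mh.
Qed.

Lemma mint_cst (R : realType) (d : nat) (S : set (euclid R d))
    (m : {measure set (euclid R d) -> \bar R}) (r : \bar R) :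
  measurable S -> mint m (cst r : S -> \bar R) = r * m S.
Proof.
move=> mS; rewrite -integral_cst//; apply: eq_integral => x xS.
by rewrite -[x]/(set_val (SigSub xS)) ext0E.
Qed.

Lemma cint_cst1 (R : realType) (d : nat) (S : set (euclid R d))
    (nu : charge_on S) : measurable S -> cint nu (cst 1) = charge_val nu S.
Proof. by move=> mS; rewrite /cint !mint_cst// !mul1e. Qed.

(* Definedness excludes [oo - oo], where negation does not distribute. *)
Lemma cint_cstN1 (R : realType) (d : nat) (S : set (euclid R d))
    (nu : charge_on S) : measurable S -> cint_defined nu (cst 1) ->
  cint nu (cst (-1)) = - charge_val nu S.
Proof.
move=> mS [_ _]; rewrite /cint /charge_val !mint_cst// !mul1e => def.
by rewrite !mulN1e oppeB// oppeK.
Qed.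

Theorem theorem2 (R : realType) (d : nat) (O : set (euclid R d))
    (oO : @open 'rV[R]_d O) (H : set (O -> \bar R))
    (Hborel : forall h, H h -> borel_fun h)
    (theta mu : charge_on O) (bal : balayage H theta mu) :
  [/\ H (cst 1) -> charge_val theta O <= charge_val mu O,
      H (cst 1) -> H (cst (-1)) -> charge_val theta O = charge_val mu O,
      forall H' : set (O -> \bar R), H' `<=` H -> balayage H' theta mu
    & forall (O' : set (euclid R d)) (oO' : @open 'rV[R]_d O') (O'O : O' `<=` O),
        csupp theta `|` csupp mu `<=` O' ->
        balayage [set h \o subfun O'O | h in H]
          (charge_restr (open_borel oO') O'O theta)
          (charge_restr (open_borel oO') O'O mu)].
Proof.
have mO := open_borel oO; have [def le_int] := bal; split.
- by move=> /le_int; rewrite !cint_cst1.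
- move=> H1 HN1; have [_ dt dm] := def _ H1.
  (* Testing against [-1] reverses the inequality given by [1]. *)
  have := le_int _ HN1; rewrite !cint_cstN1// leeN2 => mt.
  by apply/eqP; rewrite eq_le mt -!cint_cst1// le_int.
- by move=> H' H'H; split=> h /H'H; [exact: def|exact: le_int].
- move=> O' oO' O'O; rewrite subUset => -[suppt suppm].
  have mO' := open_borel oO'.
  have [tp tn] := csupp_null mO mO' suppt.
  have [mp mn] := csupp_null mO mO' suppm.
  split=> _ [h Hh <-]; have [mh dt dm] := def _ Hh.
  (* Each integral over [O'] equals the one over [O], so the conditions on the restrictions become
     those already known for [h]. *)
  + by split; [exact: borel_fun_subfun| |];
      rewrite /cint_defined /= !mint_defined_mrestr// !mint_mrestr.
  + by rewrite /cint /= !mint_mrestr//; exact: le_int.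
Qed.
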